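(* Every $\omega$-bounded topological group is selectively sequentially pseudocompact.
   Context: All topological groups are assumed to be Hausdorff. A topological space $X$ is $\omega$-bounded if the closure in $X$ of every countable subset of $X$ is compact; a topological group is $\omega$-bounded if its underlying space is. A topological space $X$ is called selectively sequentially pseudocompact if for every sequence $\{U_n:n\in\mathbb{N}\}$ of non-empty open subsets of $X$ one can choose a point $x_n\in U_n$ for every $n\in\mathbb{N}$ in such a way that the sequence $\{x_n:n\in\mathbb{N}\}$ has a subsequence converging to some point of $X$. *)

(* Defs.v *)
From HB Require Import structures.
From mathcomp Require Import all_boot all_order.
From mathcomp Require Import boolp classical_sets functions cardinality.
From mathcomp Require Import topology sequences.

Set Implicit Arguments.
Unset Strict Implicit.
Unset Printing Implicit Defensive.

Local Open Scope classical_set_scope.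

HB.mixin Record isTopologicalGroup G of Group G & Topological G := {
  mulg_continuous : continuous (fun x : G * G => (x.1 * x.2)%g);
  invg_continuous : continuous (fun x : G => (x^-1)%g)
}.

(* Possibly noncommutative, and not required to be Hausdorff: separation is
   the separate hypothesis [hausdorff_space G]. *)
#[short(type="topologicalGroupType")]
HB.structure Definition TopologicalGroup :=
  {G of isTopologicalGroup G & Group G & Topological G}.

Definition omega_bounded (X : topologicalType) : Prop :=
  forall A : set X, countable A -> compact (closure A).

Definition selectively_sequentially_pseudocompact (X : topologicalType) : Prop :=
  forall U : nat -> set X,
    (forall n, open (U n)) -> (forall n, U n !=set0) ->
    exists x : nat -> X,
      (forall n, U n (x n)) /\
      (exists (f : nat -> nat) (a : X),
         increasing_seq f /\ x \o f @ \oo --> a).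

(* Main.v *)
(** Choose [a n] in [U n]; the closure [K] of the subgroup generated by the
    [a n] is a compact group. Let [H = \bigcap_k V k], where the [V k] are
    neighbourhoods of 1 with [V k.+1 / V k.+1] contained in [V k]. If
    cosets [x_n N] of a compact subgroup [N] converge to [x N], one can pick
    [z_n] in [x_n N] that eventually enter each [x V k], and then the cosets
    [z_n (N `&` H)] converge to [x (N `&` H)] by compactness. Starting from [K],
    a cluster point of [a] and an [H] with [a n * H] inside [U n], one gets
    converging cosets contained in the sets [U (f k)]. Intersections of chains
    preserve convergence, so Zorn's lemma gives a minimal refinement, whose
    cosets are singletons, i.e. a convergent sequence. *)

Require Import Defs.
From HB Require Import structures.
From mathcomp Require Import all_boot all_order.
From mathcomp Require Import boolp classical_sets functions cardinality filter.
From mathcomp Require Import topology sequences.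

Set Implicit Arguments.
Unset Strict Implicit.
Unset Printing Implicit Defensive.

Local Open Scope classical_set_scope.
Local Open Scope group_scope.

(** * Compactness along chains of closed sets *)

Lemma compact_chain_subset (T : topologicalType) (I : Type) (D : set I)
    (F : I -> set T) (K W : set T) :
  compact K -> open W -> D !=set0 ->
  (forall i, D i -> closed (F i)) -> (forall i, D i -> F i `<=` K) ->
  (forall i j, D i -> D j -> F i `<=` F j \/ F j `<=` F i) ->
  \bigcap_(i in D) F i `<=` W -> exists2 i, D i & F i `<=` W.
Proof.
move=> cK oW [d Dd] clF FK tot FW.
(* The filter of final segments of the chain, towards smaller members; compactness of [K] is applied
   in its near-covering form along it. *)
pose tails : set_system I :=
  [set Q | exists2 i, D i & forall j, D j -> F j `<=` F i -> Q j].
have tailsF : Filter tails.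
  split; first by exists d.
  - move=> P Q [i Di iP] [j Dj jQ].
    have [ij|ji] := tot i j Di Dj.
      exists i => // k Dk ki; split; first exact: iP.
      by apply: jQ => //; exact: subset_trans ij.
    exists j => // k Dk kj; split; last exact: jQ.
    by apply: iP => //; exact: subset_trans ji.
  - by move=> P Q PQ [i Di iP]; exists i => // j Dj /(iP _ Dj)/PQ.
have := (compact_near_coveringP K).1 cK I tails (fun i x => F i x -> W x)
  tailsF.
case=> [x Kx|i Di iW].
  have [Wx|nWx] := pselect (W x).
    exists (W, setT); last by move=> [y j] [].
    by split; [exact: open_nbhs_nbhs|exact: filterT].
  have [i Di nFx] : exists2 i, D i & ~ F i x.
    apply: contrapT => h; apply: nWx; apply: FW => i Di.
    by apply: contrapT => nF; apply: h; exists i.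
  exists (~` F i, [set j | F j `<=` F i]).
    split; last by exists i.
    by apply: open_nbhs_nbhs; split => //; apply: closed_openC; exact: clF.
  by move=> [y j] [/= nFy ji] /ji.
by exists i => // x Fx; apply: (iW i Di _ x) => //; exact: FK Fx.
Qed.

(** * Continuity of the group operations, and subgroups *)

Lemma mulgl_continuous (G : topologicalGroupType) (a : G) :
  continuous (fun g => a * g).
Proof.
move=> g; apply: (@continuous2_cvg _ _ _ _ _ _ _ _ (fun x y : G => x * y)).
- exact: (mulg_continuous (a, g)).
- exact: cvg_cst.
- exact: cvg_id.
Qed.

Lemma mulgr_continuous (G : topologicalGroupType) (a : G) :
  continuous (fun g => g * a).
Proof.
move=> g; apply: (@continuous2_cvg _ _ _ _ _ _ _ _ (fun x y : G => x * y)).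
- exact: (mulg_continuous (g, a)).
- exact: cvg_id.
- exact: cvg_cst.
Qed.

Lemma divg_continuous (G : topologicalGroupType) :
  continuous (fun x : G * G => x.1 / x.2).
Proof.
move=> [x y]; apply: (@continuous2_cvg _ _ _ _ _ _ _ _ (fun x y : G => x * y)).
- exact: (mulg_continuous (x, y^-1)).
- exact: cvg_fst.
- apply: (continuous_comp (f := snd) (g := fun y : G => y^-1)).
  + exact: cvg_snd.
  + exact: invg_continuous.
Qed.

Definition subgroup (G : topologicalGroupType) (H : set G) :=
  H 1 /\ forall x y, H x -> H y -> H (x / y).

Lemma subgroupV (G : topologicalGroupType) (H : set G) x :
  subgroup H -> H x -> H x^-1.
Proof. by move=> [H1 Hdiv] Hx; rewrite -[x^-1]mul1g; exact: Hdiv. Qed.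

Lemma subgroupM (G : topologicalGroupType) (H : set G) x y :
  subgroup H -> H x -> H y -> H (x * y).
Proof.
by move=> sH Hx Hy; rewrite -[y]invgK; apply: sH.2 => //; exact: subgroupV.
Qed.

Lemma subgroup_closure (G : topologicalGroupType) (H : set G) :
  subgroup H -> subgroup (closure H).
Proof.
move=> [H1 Hdiv]; split; first exact: subset_closure.
move=> x y clx cly W nW.
have [[P Q] [/= nP nQ] PQ] := divg_continuous (x := (x, y)) nW.
have [u [Hu Pu]] := clx _ nP; have [v [Hv Qv]] := cly _ nQ.
by exists (u / v); split; [exact: Hdiv|exact: (PQ (u, v))].
Qed.

Lemma countable_subgroup (G : topologicalGroupType) (a : nat -> G) :
  exists H : set G, [/\ countable H, subgroup H & forall n, H (a n)].
Proof.
(* A letter is [a n] or its inverse, according to the boolean; the subgroup is the set of values of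
   finite words. *)
pose lt (l : bool * nat) := if l.1 then a l.2 else (a l.2)^-1.
pose word w := foldr (fun l x => lt l * x) 1 w.
pose flip (l : bool * nat) := (~~ l.1, l.2).
have wordM w w' : word (w ++ w') = word w * word w'.
  by elim: w => [|l w IH] /=; rewrite ?mul1g // IH mulgA.
have wordV w : word (rev (map flip w)) = (word w)^-1.
  elim: w => [|[b n] w IH] /=; first by rewrite invg1.
  rewrite rev_cons -cats1 wordM IH invgM /= mulg1.
  by case: b; rewrite /lt //= invgK.
exists (range word); split.
- exact: sub_countable (card_image_le _ _) (countableP _).
- split; first by exists [::].
  move=> _ _ [w _ <-] [w' _ <-].
  by exists (w ++ rev (map flip w')); rewrite // wordM wordV.
- by move=> n; exists [:: (true, n)]; rewrite //= mulg1.
Qed.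

(** * Nested neighbourhoods of the identity *)

Definition nested_nbhs (G : topologicalGroupType) (V : nat -> set G) :=
  (forall k, nbhs 1 (V k)) /\
  forall k x y, V k.+1 x -> V k.+1 y -> V k (x / y).

Lemma nested_nbhs_exists (G : topologicalGroupType) (O : nat -> set G) :
  (forall k, nbhs 1 (O k)) ->
  exists2 V, nested_nbhs V & forall k, V k `<=` O k.
Proof.
move=> nO.
have half (U : set G) : exists V : set G, nbhs 1 U ->
    nbhs 1 V /\ forall x y, V x -> V y -> U (x / y).
  (* [setT] is a dummy value that makes [s] below a total function on sets. *)
  have [nU|] := pselect (nbhs 1 U); last by exists setT.
  have nU' : nbhs ((1 : G) / 1) U by rewrite divg1.
  have [[P Q] [/= nP nQ] PQ] := divg_continuous (x := (1, 1)) nU'.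
  exists (P `&` Q) => _; split; first exact: filterI.
  by move=> x y [Px _] [_ Qy]; exact: (PQ (x, y)).
have [s sP] := choice half.
pose fix V k := if k is j.+1 then s (V j) `&` O j.+1 else O 0%N.
have nV k : nbhs 1 (V k).
  elim: k => [|k IH]; first exact: nO.
  by apply: filterI; [exact: (sP _ IH).1|exact: nO].
exists V; last by case=> [|k] // x [].
by split=> // k x y [sx _] [sy _]; exact: (sP _ (nV k)).2.
Qed.

Lemma nested_nbhs1 (G : topologicalGroupType) (V : nat -> set G) k :
  nested_nbhs V -> V k 1.
Proof. by move=> [nV _]; exact: nbhs_singleton. Qed.

Lemma nested_nbhsS (G : topologicalGroupType) (V : nat -> set G) j k :
  nested_nbhs V -> (j <= k)%N -> V k `<=` V j.
Proof.
move=> nV /subnK <-; elim: (k - j)%N => [|i IH] // x Vx; apply: IH.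
by rewrite -[x]divg1; apply: nV.2 => //; exact: nested_nbhs1.
Qed.

(** For [z] in the closure, the translate of [V k.+1] by [z] meets [V k.+1] in some [v], and [z] is
    the quotient of [v] by [z^-1 * v]. *)
Lemma nested_nbhs_closure (G : topologicalGroupType) (V : nat -> set G) k :
  nested_nbhs V -> closure (V k.+1) `<=` V k.
Proof.
move=> nV z clz.
have nz : nbhs z [set g | V k.+1 (z^-1 * g)].
  by apply: (mulgl_continuous (x := z)); rewrite mulVg; exact: nV.1.
have [v [Vv Vzv]] := clz _ nz.
have -> : z = v / (z^-1 * v) by rewrite invgM invgK mulVKg.
exact: nV.2.
Qed.

Lemma nested_nbhs_subgroup (G : topologicalGroupType) (V : nat -> set G) :
  nested_nbhs V -> subgroup (\bigcap_k V k).
Proof.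
move=> nV; split=> [k _|x y Hx Hy k _]; first exact: nested_nbhs1.
by apply: nV.2; [exact: Hx|exact: Hy].
Qed.

Lemma nested_nbhs_closed (G : topologicalGroupType) (V : nat -> set G) :
  nested_nbhs V -> closed (\bigcap_k V k).
Proof.
move=> nV x clx k _; apply: (nested_nbhs_closure nV).
by apply: closureS clx => y; apply.
Qed.

(** * Convergent families of cosets and their refinement *)

(* Encodes a sequence [x_n N] of left cosets of a compact subgroup [N]
   converging to the coset [x N], stored at [None]. The subgroup is implicit:
   the third condition says that all the [A i] are left cosets of it. *)
Definition convergent_cosets (G : topologicalGroupType)
    (A : option nat -> set G) :=
  [/\ forall i, A i !=set0,
      forall i, compact (A i),
      forall i j x y z, A i x -> A i y -> A j z -> A j (z / x * y) &
      forall W, open W -> A None `<=` W ->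
        \forall n \near \oo, A (Some n) `<=` W].

(** If the [A i] are left cosets of [N], [H] is a subgroup and [p i] lies in [A i], this is the left
    coset of [N]&[H] through [p i]. *)
Definition coset_refinement (G : topologicalGroupType)
    (A : option nat -> set G) (H : set G) (p : option nat -> G)
    (i : option nat) :=
  A i `&` [set g | H ((p i)^-1 * g)].

Lemma coset_refinement_convergent (G : topologicalGroupType)
    (hG : hausdorff_space G) (A : option nat -> set G) (V : nat -> set G)
    (p : option nat -> G) :
  convergent_cosets A -> nested_nbhs V -> (forall i, A i (p i)) ->
  (forall k, \forall n \near \oo, V k ((p None)^-1 * p (Some n))) ->
  convergent_cosets (coset_refinement A (\bigcap_k V k) p).
Proof.
move=> [A0 cA heapA cvA] nV Ap cvp.
have sH := nested_nbhs_subgroup nV; have clH := nested_nbhs_closed nV.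
set H := \bigcap_k V k in sH clH *.
split.
- by move=> i; exists (p i); split; rewrite //= mulVg; exact: sH.1.
- move=> i; apply: compact_closedI; first exact: cA.
  by apply: (continuous_closedP _).1 clH; exact: mulgl_continuous.
- move=> i j x y z [Ax Hx] [Ay Hy] [Az Hz]; split; first exact: (heapA i).
  rewrite /=; have -> : (p j)^-1 * (z / x * y) =
      (p j)^-1 * z / ((p i)^-1 * x) * ((p i)^-1 * y).
    by rewrite invgM invgK !mulgA mulgK.
  by apply: (subgroupM sH) => //; exact: sH.2.
- move=> W oW BW.
  (* Closures make the [C k] closed without changing their intersection, so compactness yields one
     [k] with [A None]&[C k] inside [W]. *)
  pose C k := [set g | closure (V k) ((p None)^-1 * g)].
  have clC k : closed (C k).
    apply: (continuous_closedP _).1 (@closed_closure _ (V k)).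
    exact: mulgl_continuous.
  have [k _ CW] : exists2 k, [set: nat] k & A None `&` C k `<=` W.
    apply: (compact_chain_subset (cA None)) => //.
    + move=> k _; apply: closedI => //; exact: compact_closed.
    + move=> j k _ _; wlog jk : j k / (j <= k)%N.
        by move=> h; have [/h|/ltnW /h] := leqP j k => [//|[]]; [right|left].
      right; apply: setIS => x; apply: closureS.
      exact: nested_nbhsS jk.
    + move=> x Cx; apply: BW; split; first exact: (Cx 0%N I).1.
      by move=> k _; apply: (nested_nbhs_closure nV); exact: (Cx k.+1 I).2.
  have AW : A None `<=` W `|` ~` C k.
    move=> x Ax; have [Cx|] := pselect (C k x); last by right.
    by left; exact: CW.
  have oWC : open (W `|` ~` C k) by apply: openU => //; exact: closed_openC.
  (* Eventually [A (Some n)] avoids [C k] outside [W], while the refined coset lies in [C k]: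
     [p (Some n)] is [V k.+1]-close to [p None], and [H] lies in [V k.+1]. *)
  have := cvA _ oWC AW; have := cvp k.+1; apply: filterS2 => n Vn AWn x [Ax Hx].
  have [//|nCx] := AWn x Ax; case: nCx; apply: subset_closure.
  have -> : (p None)^-1 * x =
      (p None)^-1 * p (Some n) / ((p (Some n))^-1 * x)^-1.
    by rewrite invgK -mulgA mulVKg.
  by apply: nV.2 => //; exact: (subgroupV sH Hx).
Qed.

Lemma coset_lift (G : topologicalGroupType) (A : option nat -> set G)
    (V : nat -> set G) :
  convergent_cosets A -> nested_nbhs V ->
  exists p : option nat -> G, (forall i, A i (p i)) /\
    forall k, \forall n \near \oo, V k ((p None)^-1 * p (Some n)).
Proof.
move=> [A0 cA heapA cvA] nV; have [x Ax] := A0 None.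
pose meets k n := exists2 u, A (Some n) u & V k (x^-1 * u).
have meets_near k : \forall n \near \oo, meets k n.
  (* With [A None] the coset [x N], this is the open set of products of [x], the interior of [V k]
     and [N]; right multiplication by [y^-1 * x] stays in each coset. *)
  pose W := \bigcup_(y in A None) [set g | (V k)° (x^-1 * g * (y^-1 * x))].
  have oW : open W.
    apply: bigcup_open => y _.
    have := @open_interior _ (V k).
    move=> /((continuousP _).1 (@mulgr_continuous G (y^-1 * x))).
    exact: (continuousP _).1 (@mulgl_continuous G x^-1) _.
  have AW : A None `<=` W.
    move=> y Ay; exists y => //=; rewrite mulgA mulgK mulVg.
    exact: nV.1.
  have := cvA _ oW AW; apply: filterS => n AWn.
  have [u Au] := A0 (Some n); have [y Ay Vu] := AWn _ Au.
  exists (u / y * x); first exact: (heapA None).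
  by apply: interior_subset; move: Vu; rewrite /= !mulgA.
(* The point is taken in [x V k] for the largest [k <= m] such that [A (Some n)] meets it; nesting
   covers the smaller ones. The choice [m = n] is a diagonal argument. *)
have pick n m : exists u, A (Some n) u /\
    forall k, (k <= m)%N -> meets k n -> V k (x^-1 * u).
  elim: m => [|m [u [Au uV]]].
    have [[u Au Vu]|nm] := pselect (meets 0%N n).
      by exists u; split=> // k; rewrite leqn0 => /eqP ->.
    have [u Au] := A0 (Some n); exists u; split=> // k.
    by rewrite leqn0 => /eqP ->.
  have [[v Av Vv]|nm] := pselect (meets m.+1 n).
    by exists v; split=> // k km _; exact: (nested_nbhsS nV km).
  exists u; split=> // k; rewrite leq_eqVlt => /predU1P[-> //|].
  exact: uV.
have [z zP] := choice (fun n => pick n n).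
exists (oapp z x); split=> [[n|]//=|k]; first exact: (zP n).1.
have := meets_near k; have := nbhs_infty_ge k.
by apply: filterS2 => n kn mkn; exact: (zP n).2.
Qed.

(** * Minimal families and convergent selections *)

(* Refining by an [H] that misses a quotient of two points of one coset would
   contradict minimality, so minimal families consist of singletons. *)
Lemma minimal_cosets_singleton (G : topologicalGroupType)
    (hG : hausdorff_space G) (A : option nat -> set G) :
  convergent_cosets A ->
  (forall B, convergent_cosets B -> (forall i, B i `<=` A i) ->
     forall i, A i `<=` B i) ->
  forall i x y, A i x -> A i y -> x = y.
Proof.
move=> cA minA i x y Ax Ay; apply: contrapT => xy.
have [V nV VO] : exists2 V : nat -> set G,
    nested_nbhs V & forall k, V k `<=` ~` [set x^-1 * y].
  apply: nested_nbhs_exists => _; apply: open_nbhs_nbhs; split.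
    apply: closed_openC; apply: accessible_closed_set1.
    exact: hausdorff_accessible.
  by move=> /= e; apply: xy; rewrite -[y](mulVKg x) -e mulg1.
have [p [Ap cvp]] := coset_lift cA nV.
have cB := coset_refinement_convergent hG cA nV Ap cvp.
have AB := minA _ cB (fun j z => @proj1 _ _) i.
have sH := nested_nbhs_subgroup nV.
have [_ Hx] := AB x Ax; have [_ Hy] := AB y Ay.
apply: (VO 0%N (x^-1 * y)) => //.
have -> : x^-1 * y = ((p i)^-1 * x)^-1 * ((p i)^-1 * y).
  by rewrite invgM invgK mulgA mulgK.
by apply: (subgroupM sH) => //; exact: (subgroupV sH).
Qed.

(** Zorn's lemma for reverse inclusion: a chain is bounded by its indexwise intersection, since an
    open set containing that intersection at an index already contains one member of the chain
    there. *)
Lemma minimal_cosets_exists (G : topologicalGroupType)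
    (hG : hausdorff_space G) (A : option nat -> set G) :
  convergent_cosets A ->
  exists B, [/\ convergent_cosets B, forall i, B i `<=` A i &
    forall B', convergent_cosets B' -> (forall i, B' i `<=` B i) ->
      forall i, B i `<=` B' i].
Proof.
move=> cA.
pose T := {B | convergent_cosets B /\ forall i, B i `<=` A i}.
pose R (B C : T) := `[< forall i, sval C i `<=` sval B i >].
pose A0 : T := exist _ A (conj cA (fun i => @subset_refl _ (A i))).
have [||F totF|B maxB] := @ZL_preorder T A0 R.
- by move=> B; apply/asboolP => i; exact: subset_refl.
- move=> C B D /asboolP BC /asboolP CD; apply/asboolP => i.
  exact: subset_trans (CD i) (BC i).
- have [[C FC]|nF] := pselect (F !=set0); last first.
    by exists A0 => B FB; case: nF; exists B.
  have tot i B D : F B -> F D ->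
      sval B i `<=` sval D i \/ sval D i `<=` sval B i.
    by move=> FB FD; have [/asboolP|/asboolP] := totF _ _ FB FD; [right|left].
  pose M i := \bigcap_(B in F) sval B i.
  have clF i (B : T) : closed (sval B i).
    by apply: compact_closed => //; case: (svalP B) => -[].
  have MW i W : open W -> M i `<=` W -> exists2 B, F B & sval B i `<=` W.
    move=> oW MW; have [_ cAs _ _] := cA.
    apply: (compact_chain_subset (cAs i) oW) => //; first by exists C.
    + by move=> B _; exact: (svalP B).2.
    + by move=> B D; exact: tot.
  have cM : convergent_cosets M.
    split.
    + move=> i; apply/set0P/eqP => M0.
      (* Taking the empty open set as [W] turns an empty intersection into an empty member. *)
      have [|B _ B0] := MW i set0 open0; first by rewrite M0.
      by have [[/(_ i)[x /B0]]] := svalP B.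
    + move=> i; apply: (@subclosed_compact _ _ (A i)).
      * by apply: closed_bigI => B _; exact: clF.
      * by have [_ cAs _ _] := cA.
      * by move=> x /(_ C FC); exact: (svalP C).2.
    + move=> i j x y z Mx My Mz B FB.
      have [[_ _ heapB _] _] := svalP B.
      by apply: (heapB i); [exact: Mx|exact: My|exact: Mz].
    + move=> W oW /(MW _ _ oW)[B FB BW].
      have [[_ _ _ cvB] _] := svalP B.
      apply: filterS (cvB W oW BW) => n BnW x Mx.
      by apply: BnW; exact: Mx.
  have MA i : M i `<=` A i by move=> x /(_ C FC); exact: (svalP C).2.
  exists (exist _ M (conj cM MA)) => B FB; apply/asboolP => i x Mx; exact: Mx.
- exists (sval B); have [cB BA] := svalP B; split=> // B' cB' BB'.
  have B'A i : B' i `<=` A i by exact: subset_trans (BB' i) (BA i).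
  apply/asboolP; apply: (maxB (exist _ B' (conj cB' B'A))).
  exact/asboolP.
Qed.

Lemma cosets_selection (G : topologicalGroupType) (hG : hausdorff_space G)
    (A : option nat -> set G) :
  convergent_cosets A ->
  exists (x : nat -> G) (a : G),
    (forall n, A (Some n) (x n)) /\ x @ \oo --> a.
Proof.
move=> /(minimal_cosets_exists hG)[B [cB BA minB]].
have B1 := minimal_cosets_singleton hG cB minB.
have [B0 _ _ cvB] := cB; have [b bB] := choice B0.
exists (fun n => b (Some n)), (b None); split=> [n|W nW]; first exact: BA.
have BW : B None `<=` W°.
  by move=> x Bx; rewrite (B1 _ _ _ Bx (bB None)); exact: nW.
apply: filterS (cvB _ (@open_interior _ W) BW) => n BnW.
exact: interior_subset (BnW _ (bB (Some n))).
Qed.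

(** * Subsequences at a cluster point and the selection in the group *)

Lemma cluster_subsequence (T : topologicalType) (u : nat -> T) (a : T)
    (V : nat -> set T) :
  cluster (u @ \oo) a -> (forall k, nbhs a (V k)) ->
  exists f : nat -> nat, increasing_seq f /\ forall k, V k (u (f k)).
Proof.
move=> cla nV.
have next (km : nat * nat) : exists n, (km.2 <= n)%N /\ V km.1 (u n).
  have tail : (u @ \oo) (u @` [set n | (km.2 <= n)%N]).
    by exists km.2 => // n /= kn; exists n.
  by have [_ [[n kn <-] Vn]] := cla _ _ tail (nV km.1); exists n.
have [g gP] := choice next.
(* The lower bound [(f j).+1] on the next index makes [f] strictly increasing. *)
pose fix f k := if k is j.+1 then g (k, (f j).+1) else g (0%N, 0%N).
exists f; split; last first.
  by case=> [|k]; [exact: (gP (0%N, 0%N)).2|exact: (gP (k.+1, (f k).+1)).2].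
by apply/increasing_seqP => k; exact: (gP (k.+1, (f k).+1)).1.
Qed.

Theorem theorem5p3 (G : topologicalGroupType) (hG : hausdorff_space G)
  (hb : omega_bounded G) : selectively_sequentially_pseudocompact G.
Proof.
move=> U oU U0; have [a aU] := choice U0.
have [D [cD sD aD]] := countable_subgroup a.
have cK := hb D cD; have sK := subgroup_closure sD.
set K := closure D in cK sK.
have aK n : K (a n) by exact: subset_closure.
have [V nV VU] : exists2 V : nat -> set G,
    nested_nbhs V & forall n, V n `<=` [set h | U n (a n * h)].
  apply: nested_nbhs_exists => n; apply: (mulgl_continuous (x := 1)).
  by rewrite mulg1; exact: open_nbhs_nbhs.
have [b [Kb clb]] : K `&` cluster (a @ \oo) !=set0.
  by apply: cK; exists 0%N => // n _; exact: aK.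
have [f [f_incr fV]] :
    exists f, increasing_seq f /\ forall k, V k (b^-1 * a (f k)).
  apply: (cluster_subsequence (V := fun k => [set g | V k (b^-1 * g)])) clb _.
  by move=> k; apply: (mulgl_continuous (x := b)); rewrite mulVg; exact: nV.1.
have cA : convergent_cosets (fun=> K).
  split=> //; first by move=> _; exists b.
  - move=> _ _ x y z Kx Ky Kz.
    by apply: (subgroupM sK) => //; exact: sK.2.
  - by move=> W _ KW; exists 0%N.
(* The refined coset at [Some k] is [K] cut by [a (f k) * H], hence lies in [U (f k)] by the choice
   of [V]. *)
have cB := @coset_refinement_convergent G hG (fun=> K) V
  (oapp (a \o f) b) cA nV _ _.
have [||y [c [yB yc]]] := cosets_selection hG (cB _ _).
- by case=> [n|]; [exact: aK|exact: Kb].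
- move=> k; exists k => // n /= kn; exact: (nested_nbhsS nV kn).
(* The points [y k] are placed at the indices [f k], consistently as [f] is injective; elsewhere
   [a n] serves as default. *)
have pick n : exists v, U n v /\ forall k, f k = n -> v = y k.
  have [[k fk]|nf] := pselect (exists k, f k = n).
    exists (y k); split; last first.
      by move=> j; rewrite -fk => /(incn_inj f_incr) ->.
    rewrite -(mulVKg (a n) (y k)); apply: VU; rewrite -fk.
    exact: (yB k).2.
  by exists (a n); split=> // k fk; case: nf; exists k.
have [x xP] := choice pick; exists x; split=> [n|]; first exact: (xP n).1.
exists f, c; split=> //; suff -> : x \o f = y by [].
by apply/funext => k /=; exact: (xP (f k)).2.
Qed.
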